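(* Let $(A,\cdot_A,a_A)$ be a left-symmetric algebroid over $M$ and let $(A_t,\cdot_t,a_t)$ be a deformation of it generated by $\omega\in\mathrm{Der}^2(A)$. Then $\omega$ is closed, i.e. $\mathrm{d}_{def}\omega=0$. Furthermore, if two deformations $(A_t,\cdot_t,a_t)$ and $(A'_t,\cdot'_t,a'_t)$ of $(A,\cdot_A,a_A)$, generated by $\omega$ and $\omega'$ respectively, are equivalent, then $\omega$ and $\omega'$ are in the same cohomology class in $H^2_{def}(A)$.
   Context: All vector bundles are over the same smooth manifold $M$; bundle maps cover the identity of $M$ and are $C^\infty(M)$-linear on sections. A left-symmetric algebra is a vector space with a bilinear product $\cdot$ such that $(x\cdot y)\cdot z-x\cdot(y\cdot z)=(y\cdot x)\cdot z-y\cdot(x\cdot z)$. A left-symmetric algebroid $(A,\cdot_A,a_A)$ is a vector bundle $A\to M$ with an ($\mathbb{R}$-bilinear) left-symmetric algebra structure $\cdot_A$ on $\Gamma(A)$ and a bundle map $a_A:A\to TM$ such that $x\cdot_A(fy)=f(x\cdot_A y)+a_A(x)(f)y$ and $(fx)\cdot_A y=f(x\cdot_A y)$. Write $[x,y]_A=x\cdot_Ay-y\cdot_Ax$. An isomorphism of left-symmetric algebroids is an invertible bundle map preserving products and anchors. $\mathrm{Der}^n(A)$ ($n\ge1$) is the space of $D\in\mathrm{Hom}_{\mathbb R}(\Lambda^{n-1}\Gamma(A)\otimes\Gamma(A),\Gamma(A))$ that are $C^\infty(M)$-linear in each of the first $n-1$ arguments and satisfy $D(x_1,\dots,x_{n-1},fx_n)=fD(x_1,\dots,x_n)+\sigma_D(x_1,\dots,x_{n-1})(f)x_n$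 for some $\sigma_D\in\Gamma(\mathrm{Hom}(\Lambda^{n-1}A,TM))$, the symbol of $D$. The coboundary $\mathrm{d}_{def}:\mathrm{Der}^n(A)\to\mathrm{Der}^{n+1}(A)$ is $$\begin{aligned}\mathrm{d}_{def}\omega(x_1,\dots,x_{n+1})=&\sum_{i=1}^n(-1)^{i+1}x_i\cdot_A\omega(x_1,\dots,\hat{x_i},\dots,x_{n+1})+\sum_{i=1}^n(-1)^{i+1}\omega(x_1,\dots,\hat{x_i},\dots,x_n,x_i)\cdot_Ax_{n+1}\\&-\sum_{i=1}^n(-1)^{i+1}\omega(x_1,\dots,\hat{x_i},\dots,x_n,x_i\cdot_Ax_{n+1})+\sum_{1\le i<j\le n}(-1)^{i+j}\omega([x_i,x_j]_A,x_1,\dots,\hat{x_i},\dots,\hat{x_j},\dots,x_{n+1}),\end{aligned}$$ and it satisfies $\mathrm{d}_{def}^2=0$; $H^\bullet_{def}(A)$ denotes the resulting cohomology. An element $\omega\in\mathrm{Der}^2(A)$ generates a ($1$-parameter infinitesimal) deformation of $(A,\cdot_A,a_A)$ if $A_t=(A,\cdot_t,a_t)$, with $x\cdot_ty=x\cdot_Ay+t\omega(x,y)$ and $a_t=a_A+t\sigma_\omega$, is a left-symmetric algebroid for all $t\in I$, where $I$ is an open interval containing $0$. Two deformations $A_t$ and $A'_t$ generated by $\omega$ and $\omega'$ are equivalent if there is a bundle map $N:A\to A$ such that $\mathrm{Id}+tN:A_t\to A'_t$ is a left-symmetric algebroid isomorphism for all $t\in I$. *)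

(* Defs.v *)
From HB Require Import structures.
From mathcomp Require Import all_boot all_order all_algebra.
From mathcomp Require Import all_classical all_reals all_analysis.
From mathcomp Require Import ring.

Set Implicit Arguments.
Unset Strict Implicit.
Unset Printing Implicit Defensive.

Import Order.TTheory GRing.Theory Num.Theory numFieldNormedType.Exports.

Local Open Scope classical_set_scope.
Local Open Scope ring_scope.

Section SmoothEuclidean.
Context {R : realType} {n : nat}.
Implicit Types (U V : set 'rV[R]_n) (f g : 'rV[R]_n -> R).

(* C^k on the open set U, through continuity of the iterated partial
   derivatives; values of f outside U are irrelevant. *)
Fixpoint Ck (k : nat) U f : Prop :=
  (forall y, U y -> {for y, continuous f}) /\
  (if k is k'.+1 then
     forall i : 'I_n, (forall y, U y -> derivable f y (delta_mx 0 i)) /\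
                      Ck k' U ('D_(delta_mx 0 i) f)
   else True).

Definition smooth_on U f := forall k, Ck k U f.

Lemma Ck_subset k U V f : V `<=` U -> Ck k U f -> Ck k V f.
Proof.
elim: k f => [|k IH] f VU /= [cf H]; split=> //.
- by move=> y /VU /cf.
- by move=> y /VU /cf.
- by move=> i; have [h1 h2] := H i; split=> [y /VU /h1 //|]; exact: IH.
Qed.

Lemma CkW k U f : Ck k.+1 U f -> Ck k U f.
Proof.
elim: k f => [|k IH] f /= [cf H]; split=> // i.
by have [h1 h2] := H i; split=> //; exact: IH.
Qed.

Lemma eq_Ck k U f g : open U -> (forall y, U y -> f y = g y) ->
  Ck k U f -> Ck k U g.
Proof.
move=> oU.
have nearfg h1 h2 y : (forall y, U y -> h1 y = h2 y) -> U y ->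
    \forall z \near y, (h1 : _ -> R) z = h2 z.
  move=> fg Uy; have : open_nbhs y U by split.
  by move/open_nbhs_nbhs; apply: filterS => z /fg.
have ctsfg h1 h2 y : (forall y, U y -> h1 y = h2 y) -> U y ->
    {for y, continuous (h1 : _ -> R)} -> {for y, continuous h2}.
  move=> fg Uy c1; rewrite /prop_for /continuous_at -fg//.
  apply: cvg_trans c1.
  exact: (@near_eq_cvg _ _ (nbhs y) _ _ _ (nearfg _ _ _ fg Uy)).
elim: k f g => [|k IH] f g fg /= [cf H]; split=> //.
- by move=> y Uy; apply: (ctsfg f) => //; exact: cf.
- by move=> y Uy; apply: (ctsfg f) => //; exact: cf.
- move=> i; have [df Cf] := H i; split=> [y Uy|].
    by apply: near_eq_derivable (df y Uy); exact: (nearfg _ _ _ fg Uy).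
  apply: IH Cf => y Uy.
  by apply: near_eq_derive; exact: (nearfg _ _ _ fg Uy).
Qed.

Lemma Ck_cst k U (a : R) : Ck k U (cst a).
Proof.
elim: k a => [|k IH] a /=; split=> //.
- by move=> y _; exact: cst_continuous.
- by move=> y _; exact: cst_continuous.
- move=> i; split=> [y _|]; first exact: derivable_cst.
  have -> : 'D_(delta_mx 0 i) (cst a) = cst (0 : R) :> ('rV[R]_n -> R).
    by apply/funext => y; rewrite derive_cst.
  exact: IH.
Qed.

Lemma Ck_add k U f g : open U -> Ck k U f -> Ck k U g -> Ck k U (f + g).
Proof.
move=> oU; elim: k f g => [|k IH] f g /= [cf Hf] [cg Hg]; split=> //.
- move=> y Uy; exact: (continuousD (cf y Uy) (cg y Uy)).
- move=> y Uy; exact: (continuousD (cf y Uy) (cg y Uy)).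
- move=> i; have [df Cf] := Hf i; have [dg Cg] := Hg i; split=> [y Uy|].
    by apply: derivableD; [exact: df|exact: dg].
  apply: eq_Ck (IH _ _ Cf Cg) => // y Uy.
  by rewrite deriveD; [|exact: df|exact: dg].
Qed.

Lemma Ck_mul k U f g : open U -> Ck k U f -> Ck k U g -> Ck k U (f * g).
Proof.
move=> oU; elim: k f g => [|k IH] f g.
  move=> /= [cf Hf] [cg Hg]; split=> // y Uy.
  exact: (continuousM (cf y Uy) (cg y Uy)).
move=> Cf0 Cg0; have Cf1 := CkW Cf0; have Cg1 := CkW Cg0.
move: Cf0 Cg0 => /= [cf Hf] [cg Hg]; split=> [y Uy|i].
  exact: (continuousM (cf y Uy) (cg y Uy)).
have [df Cf] := Hf i; have [dg Cg] := Hg i; split=> [y Uy|].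
  by apply: derivableM; [exact: df|exact: dg].
apply: eq_Ck (Ck_add oU (IH _ _ Cf1 Cg) (IH _ _ Cg1 Cf)) => // y Uy.
by rewrite deriveM; [|exact: df|exact: dg].
Qed.

End SmoothEuclidean.

Section Manifold.
Context {R : realType} {n : nat}.

(* [cmap] is only meaningful on [cdom], [cinv] only on [cmap @` cdom]. *)
Record chart (M : topologicalType) := Chart {
  cdom : set M;
  cmap : M -> 'rV[R]_n;
  cinv : 'rV[R]_n -> M;
  cdom_open : open cdom;
  cimg_open : open (cmap @` cdom);
  cmapK : forall p, cdom p -> cinv (cmap p) = p;
  cmap_cts : {within cdom, continuous cmap};
  cinv_cts : {within cmap @` cdom, continuous cinv}
}.

End Manifold.
Arguments chart R n M : clear implicits.

Record manifold (R : realType) (n : nat) := Manifold {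
  carrier :> topologicalType;
  atlas : set (chart R n carrier);
  manifold_hausdorff : hausdorff_space carrier;
  manifold_countable : @second_countable carrier;
  atlas_cover : forall p, exists2 c, atlas c & cdom c p;
  atlas_compat : forall c c', atlas c -> atlas c' -> forall j : 'I_n,
    smooth_on (cmap c @` (cdom c `&` cdom c')) (fun y => cmap c' (cinv c y) 0 j)
}.

Arguments atlas {R n} _ _.

Section SmoothFunctions.
Context {R : realType} {n : nat} (M : manifold R n).
Implicit Types (U : set M) (f g : M -> R).

Definition msmooth_on U f :=
  forall c, atlas M c -> smooth_on (cmap c @` (cdom c `&` U)) (f \o cinv c).

Lemma chart_img_open (c : chart R n M) U : open U -> open (cmap c @` (cdom c `&` U)).
Proof.
move=> oU.
have := @cinv_cts _ _ _ c; rewrite (continuous_open_subspace _ (@cimg_open _ _ _ c)) => cc.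
have -> : cmap c @` (cdom c `&` U) =
    (cmap c @` cdom c) `&` (cinv c @^-1` U).
  apply/seteqP; split=> [_ [p [dp Up] <-]|_ [[p dp <-]]] /=.
    by split; [exists p|rewrite cmapK].
  by rewrite cmapK// => Up; exists p.
rewrite openE => y [Ay Uy].
apply: filterI; first by apply: open_nbhs_nbhs; split=> //; exact: cimg_open.
by apply: (cc y (mem_set Ay)); exact: open_nbhs_nbhs.
Qed.

Lemma msmooth_subset U V f : V `<=` U -> msmooth_on U f -> msmooth_on V f.
Proof.
move=> VU sf c Ac k; apply: Ck_subset (sf c Ac k).
by move=> _ [p [dp Vp] <-]; exists p => //; split=> //; exact: VU.
Qed.

Lemma msmooth_cst U (a : R) : msmooth_on U (cst a).
Proof. by move=> c _ k; exact: Ck_cst. Qed.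

Lemma msmoothD U f g : open U ->
  msmooth_on U f -> msmooth_on U g -> msmooth_on U (f + g).
Proof.
move=> oU sf sg c Ac k.
exact: (Ck_add (chart_img_open oU) (sf c Ac k) (sg c Ac k)).
Qed.

Lemma msmoothM U f g : open U ->
  msmooth_on U f -> msmooth_on U g -> msmooth_on U (f * g).
Proof.
move=> oU sf sg c Ac k.
exact: (Ck_mul (chart_img_open oU) (sf c Ac k) (sg c Ac k)).
Qed.

Definition smooth_fun_pred : {pred M -> R} :=
  mem [set f : M -> R | msmooth_on setT f].

Lemma smooth_fun_subring : subring_closed smooth_fun_pred.
Proof.
have sN f : msmooth_on setT f -> msmooth_on setT (- f).
  move=> sf; rewrite -mulN1r; apply: msmoothM => //; first exact: openT.
  exact: (msmooth_cst _ (-1)).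
split; first by apply/mem_set; exact: (msmooth_cst _ 1).
- move=> f g /set_mem sf /set_mem sg; apply/mem_set.
  by apply: msmoothD; [exact: openT| |exact: sN].
- by move=> f g /set_mem sf /set_mem sg; apply/mem_set/msmoothM => //; exact: openT.
Qed.

Lemma smooth_fun_submod : submod_closed smooth_fun_pred.
Proof.
have [s1 sB sM] := smooth_fun_subring.
split; first by apply/mem_set; exact: (msmooth_cst _ 0).
move=> a f g sf /set_mem sg; apply/mem_set; apply: msmoothD => //.
  exact: openT.
have -> : a *: f = cst a * f by [].
apply/set_mem; apply: sM => //; apply/mem_set; exact: msmooth_cst.
Qed.

HB.instance Definition _ :=
  GRing.isSubringClosed.Build (M -> R) smooth_fun_pred smooth_fun_subring.
HB.instance Definition _ :=
  GRing.isSubmodClosed.Build R (M -> R) smooth_fun_pred smooth_fun_submod.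

Record smooth_fun := SmoothFun {
  smooth_fun_val :> M -> R;
  smooth_funP : smooth_fun_val \in smooth_fun_pred }.
HB.instance Definition _ := [isSub for smooth_fun_val].
HB.instance Definition _ := [Choice of smooth_fun by <:].
HB.instance Definition _ :=
  GRing.SubChoice_isSubComPzRing.Build _ _ smooth_fun (subringClosedP _).
HB.instance Definition _ := [SubZmodule_isSubLmodule of smooth_fun by <:].

End SmoothFunctions.
Arguments smooth_fun_pred {R n} M _.

(* The tangent space at [p]: derivations of the algebra of smooth functions
   at [p]. *)
Section TangentSpace.
Context {R : realType} {n : nat} (M : manifold R n) (p : M).

Definition tangent_pred : {pred smooth_fun M -> R} :=
  mem [set v : smooth_fun M -> R |
    scalar v /\ forall f g, v (f * g) = f p * v g + g p * v f].

Lemma tangent_submod : submod_closed tangent_pred.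
Proof.
split=> [|a v w /set_mem [lv dv] /set_mem [lw dw]]; apply/mem_set; split.
- by move=> a f g /=; rewrite /GRing.zero/= mulr0 addr0.
- by move=> f g /=; rewrite /GRing.zero/= !mulr0 addr0.
- move=> b f g; rewrite !fctE /= lv lw.
  by rewrite /GRing.scale /=; ring.
- move=> f g; rewrite !fctE /= dv dw.
  by rewrite /GRing.scale /=; ring.
Qed.

HB.instance Definition _ :=
  GRing.isSubmodClosed.Build R (smooth_fun M -> R) tangent_pred tangent_submod.

Record tangent := Tangent {
  tangent_val :> smooth_fun M -> R;
  tangentP : tangent_val \in tangent_pred }.
HB.instance Definition _ := [isSub for tangent_val].
HB.instance Definition _ := [Choice of tangent by <:].
HB.instance Definition _ := [SubChoice_isSubLmodule of tangent by <:].

End TangentSpace.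

(* All sections, not necessarily smooth, of a family of vector spaces. *)
Section FamilySections.
Context {R : realType} {M : Type} (E : M -> lmodType R).

Definition fsec := forall p, E p.
HB.instance Definition _ := Choice.copy fsec (forall p, E p).

Let fsec0 : fsec := fun=> 0.
Let fsecN (s : fsec) : fsec := fun p => - s p.
Let fsecD (s t : fsec) : fsec := fun p => s p + t p.
Let fsecZ (a : R) (s : fsec) : fsec := fun p => a *: s p.

Let fsecDA : associative fsecD.
Proof. by move=> r s t; apply: functional_extensionality_dep => p; exact: addrA. Qed.
Let fsecDC : commutative fsecD.
Proof. by move=> s t; apply: functional_extensionality_dep => p; exact: addrC. Qed.
Let fsec0D : left_id fsec0 fsecD.
Proof. by move=> s; apply: functional_extensionality_dep => p; exact: add0r. Qed.
Let fsecND : left_inverse fsec0 fsecN fsecD.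
Proof. by move=> s; apply: functional_extensionality_dep => p; exact: addNr. Qed.
HB.instance Definition _ :=
  GRing.isZmodule.Build fsec fsecDA fsecDC fsec0D fsecND.

Let fsecZA a b s : fsecZ a (fsecZ b s) = fsecZ (a * b) s.
Proof. by apply: functional_extensionality_dep => p; exact: scalerA. Qed.
Let fsec1Z : left_id 1 fsecZ.
Proof. by move=> s; apply: functional_extensionality_dep => p; exact: scale1r. Qed.
Let fsecZDr : right_distributive fsecZ +%R.
Proof. by move=> a s t; apply: functional_extensionality_dep => p; exact: scalerDr. Qed.
Let fsecZDl s : {morph fsecZ^~ s : a b / a + b}.
Proof. by move=> a b; apply: functional_extensionality_dep => p; exact: scalerDl. Qed.
HB.instance Definition _ :=
  GRing.Zmodule_isLmodule.Build R fsec fsecZA fsec1Z fsecZDr fsecZDl.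

End FamilySections.
Identity Coercion fun_of_fsec : fsec >-> Funclass.

Section VectorBundle.
Context {R : realType} {n : nat} (M : manifold R n).

(* [tmap p] is only meaningful for [p] in [tdom]. *)
Record trivialization (E : M -> lmodType R) (r : nat) := Trivialization {
  tdom : set M;
  tmap : forall p, {linear E p -> 'rV[R]_r};
  tinv : forall p, 'rV[R]_r -> E p;
  tdom_open : open tdom;
  tmapK : forall p, tdom p -> cancel (tmap p) (tinv p);
  tinvK : forall p, tdom p -> cancel (tinv p) (tmap p)
}.

(* The topology and smooth structure of the total space are those determined
   by the fibrewise linear trivializations and their smooth transition
   functions. *)
Record vbundle := VBundle {
  fiber :> M -> lmodType R;
  rank : nat;
  tatlas : set (trivialization fiber rank);
  tatlas_cover : forall p, exists2 t, tatlas t & tdom t p;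
  tatlas_compat : forall t t', tatlas t -> tatlas t' ->
    forall (v : 'rV[R]_rank) (j : 'I_rank),
    msmooth_on (tdom t `&` tdom t') (fun p => tmap t' p (tinv t p v) 0 j)
}.

End VectorBundle.
Arguments tatlas {R n M} _ _.

Section Sections.
Context {R : realType} {n : nat} {M : manifold R n} (A : vbundle M).

Definition ssec_on (U : set M) (s : fsec A) :=
  forall t, tatlas A t -> forall j,
    msmooth_on (U `&` tdom t) (fun p => tmap t p (s p) 0 j).

Definition section_pred : {pred fsec A} := mem [set s | ssec_on setT s].

Lemma ssec_onD U s t : open U -> ssec_on U s -> ssec_on U t -> ssec_on U (s + t).
Proof.
move=> oU ss st u Au j.
have -> : (fun p => tmap u p ((s + t) p) 0 j) =
    (fun p => tmap u p (s p) 0 j) + (fun p => tmap u p (t p) 0 j).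
  by apply/funext => p; rewrite /= linearD mxE.
by apply: msmoothD; [apply: openI => //; exact: tdom_open|exact: ss|exact: st].
Qed.

Lemma ssec_onM U (f : M -> R) s : open U -> msmooth_on U f -> ssec_on U s ->
  ssec_on U ((fun p => f p *: s p) : fsec A).
Proof.
move=> oU sf ss u Au j.
have -> : (fun p => tmap u p (f p *: s p) 0 j) =
    f * (fun p => tmap u p (s p) 0 j).
  by apply/funext => p; rewrite linearZ mxE.
apply: msmoothM; [apply: openI => //; exact: tdom_open| |exact: ss].
by apply: msmooth_subset sf => p [].
Qed.

Lemma section_submod : submod_closed section_pred.
Proof.
split=> [|a s t /set_mem ss /set_mem st]; apply/mem_set.
  move=> t At j.
  have -> : (fun p => tmap t p ((0 : fsec A) p) 0 j) = cst 0.
    by apply/funext => p; rewrite linear0 mxE.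
  exact: msmooth_cst.
apply: ssec_onD => //; first exact: openT.
by apply: (@ssec_onM _ (cst a)) => //; [exact: openT|exact: msmooth_cst].
Qed.

HB.instance Definition _ :=
  GRing.isSubmodClosed.Build R (fsec A) section_pred section_submod.

Record section := Section_ {
  section_val :> fsec A;
  sectionP : section_val \in section_pred }.
HB.instance Definition _ := [isSub for section_val].
HB.instance Definition _ := [Choice of section by <:].
HB.instance Definition _ := [SubChoice_isSubLmodule of section by <:].

Lemma fscale_subproof (f : smooth_fun M) (s : section) :
  ((fun p => f p *: s p) : fsec A) \in section_pred.
Proof.
apply/mem_set; apply: ssec_onM; first exact: openT.
  exact: set_mem (smooth_funP f).
exact: set_mem (sectionP s).
Qed.

Definition fscale (f : smooth_fun M) (s : section) : section :=
  Section_ (fscale_subproof f s).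

End Sections.
Arguments section_pred {R n M} A _.

Notation "f ** s" := (fscale f s) (at level 40, left associativity) : ring_scope.

Section BundleMaps.
Context {R : realType} {n : nat} {M : manifold R n}.

(* Bundle maps over the identity: fibrewise linear and smooth, smoothness being
   expressed by taking smooth local sections to smooth local sections. *)
Record bundle_map (A B : vbundle M) := BundleMap {
  bmap :> forall p, {linear A p -> B p};
  bmap_smooth : forall (U : set M) (s : fsec A), open U ->
    ssec_on U s -> ssec_on U ((fun p => bmap p (s p)) : fsec B)
}.

Lemma bmap_section_subproof (A B : vbundle M) (F : bundle_map A B) (s : section A) :
  ((fun p => F p (s p)) : fsec B) \in section_pred B.
Proof.
by apply/mem_set/bmap_smooth; [exact: openT|exact: set_mem (sectionP s)].
Qed.

Definition bmap_section (A B : vbundle M) (F : bundle_map A B) (s : section A) :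
  section B := Section_ (bmap_section_subproof F s).

Section IdPlus.
Variables (A : vbundle M) (t : R) (N : bundle_map A A).

Definition id_plus_fun (p : M) (v : A p) : A p := v + t *: N p v.

Lemma id_plus_linear p : linear (@id_plus_fun p).
Proof.
move=> a u v; rewrite /id_plus_fun linearP !scalerDr !scalerA (mulrC t a).
by rewrite addrACA.
Qed.
HB.instance Definition _ p :=
  GRing.isLinear.Build R (A p) (A p) *:%R (@id_plus_fun p) (@id_plus_linear p).

Lemma id_plus_smooth (U : set M) (s : fsec A) : open U -> ssec_on U s ->
  ssec_on U ((fun p => id_plus_fun (s p)) : fsec A).
Proof.
move=> oU ss; apply: (@ssec_onD _ _ _ _ _ s) => //.
apply: (@ssec_onM _ _ _ _ _ (cst t)) => //; first exact: msmooth_cst.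
exact: bmap_smooth.
Qed.

Definition id_plus : bundle_map A A := BundleMap id_plus_smooth.

End IdPlus.
End BundleMaps.

Definition upd {I : eqType} {T : Type} (x : I -> T) (i : I) (u : T) : I -> T :=
  fun j => if j == i then u else x j.

Definition alternating_multilinear {R : realType} {V W : lmodType R} (k : nat)
    (f : ('I_k -> V) -> W) : Prop :=
  (forall i x, linear (fun u => f (upd x i u))) /\
  (forall x i j, i != j -> x i = x j -> f x = 0).

(* Smooth sections of Hom(Lambda^k A, TM). A vector field X on an open set U is
   smooth when X f is smooth on U for every smooth function f on M. *)
Section HomToTangent.
Context {R : realType} {n : nat} {M : manifold R n} (A : vbundle M) (k : nat).

Definition hom_fiber (p : M) : lmodType R := ('I_k -> A p) -> tangent p.

Definition hom_tangent_pred : {pred fsec hom_fiber} :=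
  mem [set sigma : fsec hom_fiber |
    (forall p, alternating_multilinear (sigma p)) /\
    (forall (U : set M) (x : 'I_k -> fsec A), open U ->
      (forall i, ssec_on U (x i)) ->
      forall f : smooth_fun M,
        msmooth_on U (fun p => sigma p (x^~ p) f))].

Lemma hom_tangent_submod : submod_closed hom_tangent_pred.
Proof.
split=> [|a s t /set_mem [ls ss] /set_mem [lt st]]; apply/mem_set; split.
- by move=> p; split=> // i x b u v; rewrite scaler0 addr0.
- by move=> U x _ _ f; exact: (msmooth_cst _ 0).
- move=> p; have [l1 a1] := ls p; have [l2 a2] := lt p; split.
    move=> i x b u v.
    have e1 : s p (upd x i (b *: u + v)) =
      b *: s p (upd x i u) + s p (upd x i v) := l1 i x b u v.
    have e2 : t p (upd x i (b *: u + v)) =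
      b *: t p (upd x i u) + t p (upd x i v) := l2 i x b u v.
    suff : a *: s p (upd x i (b *: u + v)) + t p (upd x i (b *: u + v)) =
      b *: (a *: s p (upd x i u) + t p (upd x i u)) +
      (a *: s p (upd x i v) + t p (upd x i v)) by [].
    by rewrite e1 e2 !scalerDr !scalerA (mulrC a b) addrACA.
  move=> x i j ij xij; suff : a *: s p x + t p x = 0 by [].
  by rewrite (a1 x i j ij xij) (a2 x i j ij xij) scaler0 addr0.
- move=> U x oU sx f.
  apply: (@msmoothD _ _ _ _ (fun p => a * s p (x^~ p) f)) => //; last exact: st.
  apply: (@msmoothM _ _ _ _ (cst a)) => //; first exact: msmooth_cst.
  exact: ss.
Qed.

HB.instance Definition _ :=
  GRing.isSubmodClosed.Build R (fsec hom_fiber) hom_tangent_pred hom_tangent_submod.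

Record hom_tangent := HomTangent {
  hom_tangent_val :> fsec hom_fiber;
  hom_tangentP : hom_tangent_val \in hom_tangent_pred }.
HB.instance Definition _ := [isSub for hom_tangent_val].
HB.instance Definition _ := [Choice of hom_tangent by <:].
HB.instance Definition _ := [SubChoice_isSubLmodule of hom_tangent by <:].

Lemma hom_act_subproof (sigma : hom_tangent) (x : 'I_k -> section A)
    (f : smooth_fun M) :
  (fun p => sigma p (x^~ p) f) \in smooth_fun_pred M.
Proof.
have [_ ss] := set_mem (hom_tangentP sigma).
apply/mem_set; apply: (ss setT (fun i => x i)); first exact: openT.
by move=> i; exact: set_mem (sectionP (x i)).
Qed.

Definition hom_act (sigma : hom_tangent) (x : 'I_k -> section A)
    (f : smooth_fun M) : smooth_fun M :=
  SmoothFun (hom_act_subproof sigma x f).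

End HomToTangent.

Section LeftSymmetricAlgebroid.
Context {R : realType} {n : nat} {M : manifold R n}.

(* A bundle map A -> TM is a section of Hom(A, TM) = Hom(Lambda^1 A, TM). *)
Record algebroid_data (A : vbundle M) := AlgebroidData {
  lprod : section A -> section A -> section A;
  lanchor : hom_tangent A 1
}.

Definition anchor_act (A : vbundle M) (L : algebroid_data A) (x : section A) :=
  hom_act (lanchor L) (fun=> x).

Definition left_symmetric (V : zmodType) (mu : V -> V -> V) : Prop :=
  forall x y z, mu (mu x y) z - mu x (mu y z) = mu (mu y x) z - mu y (mu x z).

Definition left_symmetric_algebroid (A : vbundle M) (L : algebroid_data A) : Prop :=
  let mu := lprod L in
  [/\ (forall x, linear (mu x)) /\ (forall y, linear (mu^~ y)),
      left_symmetric mu,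
      forall x f y, mu x (f ** y) = f ** mu x y + anchor_act L x f ** y &
      forall f x y, mu (f ** x) y = f ** mu x y].

Definition algebroid_iso (A B : vbundle M)
    (L : algebroid_data A) (L' : algebroid_data B) (F : bundle_map A B) : Prop :=
  [/\ exists G : bundle_map B A,
        forall p, cancel (F p) (G p) /\ cancel (G p) (F p),
      forall x y, bmap_section F (lprod L x y) =
                  lprod L' (bmap_section F x) (bmap_section F y) &
      forall p (v : A p), lanchor L' p (fun=> F p v) = lanchor L p (fun=> v)].

End LeftSymmetricAlgebroid.

Section DeformationComplex.
Context {R : realType} {n : nat} {M : manifold R n} (A : vbundle M).
Local Notation Gamma := (section A).

(* [D x y] with [x = (x_1, ..., x_(m-1))] is D(x_1, ..., x_(m-1), y). Only
   m >= 1 is meaningful. *)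
Definition cochain (m : nat) := ('I_m.-1 -> Gamma) -> Gamma -> Gamma.

Definition is_symbol m (D : cochain m) (sigma : hom_tangent A m.-1) : Prop :=
  forall x (f : smooth_fun M) y,
    D x (f ** y) = f ** D x y + hom_act sigma x f ** y.

Definition Der m : set (cochain m) :=
  [set D | [/\ forall i x f u v y,
                 D (upd x i (f ** u + v)) y =
                 f ** D (upd x i u) y + D (upd x i v) y,
               forall x i j y, i != j -> x i = x j -> D x y = 0,
               forall x, linear (D x) &
               exists sigma, is_symbol D sigma]].

Arguments Der : clear implicits.

(* For m >= 2 the symbol of an element of [Der m] is unique. *)
Definition symbol m (D : cochain m) : hom_tangent A m.-1 :=
  xget 0 [set sigma | is_symbol D sigma].

Variable L : algebroid_data A.
Local Notation "x <.> y" := (lprod L x y) (at level 40, left associativity).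

Definition bracket (x y : Gamma) : Gamma := x <.> y - y <.> x.

(* The list ([x_i, x_j], x_1, .., x_i omitted, .., x_j omitted, .., x_m). *)
Definition bracket_args m (x : 'I_m -> Gamma) (i j : 'I_m) : 'I_m.-1 -> Gamma :=
  fun k => nth 0 (bracket (x i) (x j) ::
                  [seq x l | l <- enum 'I_m & (l != i) && (l != j)]) k.

(* Indices start at 0 here: with i = i_0 + 1 the sign (-1)^(i+1) is
   (-1)^(i_0), and (-1)^(i+j) is (-1)^(i_0+j_0). *)
Definition d_def m (w : cochain m) : cochain m.+1 := fun (x : 'I_m -> Gamma) z =>
  \sum_(i < m) (-1) ^+ i *: (x i <.> w (x \o lift i) z)
  + \sum_(i < m) (-1) ^+ i *: (w (x \o lift i) (x i) <.> z)
  - \sum_(i < m) (-1) ^+ i *: w (x \o lift i) (x i <.> z)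
  + \sum_(i < m) \sum_(j < m | (i < j)%N)
      (-1) ^+ (i + j) *: w (bracket_args x i j) z.

Definition cocycles m : set (cochain m) := [set w | Der m w /\ d_def w = 0].

Definition coboundaries m : set (cochain m) :=
  if m is m'.+2 then [set d_def th | th in Der m'.+1] else [set 0].

Arguments cocycles : clear implicits.
Arguments coboundaries : clear implicits.

(* H^m as the set of cosets w + B^m, for w a cocycle. *)
Definition H_def m : set (set (cochain m)) :=
  [set [set w + b | b in coboundaries m] | w in cocycles m].

Definition deform (w : cochain 2) (t : R) : algebroid_data A := {|
  lprod := fun x y => x <.> y + t *: w (fun=> x) y;
  lanchor := lanchor L + t *: symbol w |}.

Definition generates_deformation (I : set R) (w : cochain 2) : Prop :=
  Der 2 w /\ forall t, I t -> left_symmetric_algebroid (deform w t).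

Definition equivalent_deformations (I : set R) (w w' : cochain 2) : Prop :=
  exists N : bundle_map A A,
    forall t, I t -> algebroid_iso (deform w t) (deform w' t) (id_plus t N).

End DeformationComplex.
Arguments Der {R n M} A m _.
Arguments cocycles {R n M A} L m _.
Arguments coboundaries {R n M A} L m _.
Arguments H_def {R n M A} L m _.

(* Main.v *)
Require Import Defs.
From mathcomp Require Import all_boot all_order all_algebra.
From mathcomp Require Import all_classical all_reals all_analysis.
From mathcomp Require Import ring lra.
Import GRing.Theory Num.Theory numFieldNormedType.Exports.
Local Open Scope classical_set_scope.
Local Open Scope ring_scope.

(* Every defining equation of a deformation, and of an equivalence of
   deformations, is polynomial of degree at most 3 in t with coefficients in the
   sections, and has zero constant term; since it holds for all t near 0, its
   coefficient of t vanishes. For left-symmetry of the product that coefficient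
   is -(d_def w); for multiplicativity of Id + t N it is w - w' - d_def N, where
   N is a 1-cochain with zero symbol. *)

(** [V] carries no topology, so the expression cannot be differentiated at 0. Instead, finitely many
    of its values near 0 are combined linearly so that only a nonzero multiple of [p] survives. *)
Lemma cubic_coef1_eq0 (R : realType) (V : lmodType R) (I : set R) (p q r : V) :
  open I -> I 0 ->
  (forall t, I t -> t *: p + t ^+ 2 *: q + t ^+ 3 *: r = 0) -> p = 0.
Proof.
move=> oI I0 h.
have /nbhs_ballP[e /= e0 eI] : nbhs (0 : R) I by apply: open_nbhs_nbhs.
have {}h s : `|s| < e -> s *: p + s ^+ 2 *: q + s ^+ 3 *: r = 0.
  by move=> se; apply/h/eI; rewrite /ball /= sub0r normrN.
have D a b c a' b' c' : (a *: p + b *: q + c *: r) + (a' *: p + b' *: q + c' *: r) =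
    (a + a') *: p + (b + b') *: q + (c + c') *: r.
  by rewrite addrACA -scalerDl; congr (_ + _); rewrite addrACA -!scalerDl.
have Z k a b c : k *: (a *: p + b *: q + c *: r) =
    (k * a) *: p + (k * b) *: q + (k * c) *: r.
  by rewrite !scalerDr !scalerA.
pose F s := s *: p + s ^+ 2 *: q + s ^+ 3 *: r.
(* Small enough that [s], [- s] and [2 * s] all have absolute value below [e]. *)
pose s := e / 4.
(* The weights 6, -2, -1 at s, -s, 2s cancel the terms of order 2 and 3. *)
have : 6 *: F s + (-2) *: F (- s) + (-1) *: F (2 * s) = 0.
  by rewrite /F !h ?scaler0 ?addr0// ?normrN ger0_norm /s; lra.
rewrite /F !Z !D.
have -> : 6 * s + -2 * - s + -1 * (2 * s) = 6 * s by ring.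
have -> : 6 * s ^+ 2 + -2 * (- s) ^+ 2 + -1 * (2 * s) ^+ 2 = 0 by ring.
have -> : 6 * s ^+ 3 + -2 * (- s) ^+ 3 + -1 * (2 * s) ^+ 3 = 0 by ring.
rewrite !scale0r !addr0 => /eqP; rewrite scaler_eq0 => /orP[s0|/eqP//].
by exfalso; move: s0 => /eqP; rewrite /s; lra.
Qed.

(** Has the shape of the first clause of [left_symmetric_algebroid], so the two are convertible. *)
Definition bilinear_op {R : pzRingType} {V : lmodType R} (m : V -> V -> V) :=
  (forall x, linear (m x)) /\ (forall y, linear (m^~ y)).

Lemma linear_at0 {R : pzRingType} {U V : lmodType R} {f : U -> V} :
  linear f -> f 0 = 0.
Proof. by move=> lf; have := lf (-1) 0 0; rewrite !scaleN1r oppr0 addr0 addNr. Qed.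

Section BilinearPencil.
Context {R : realType} {V : lmodType R}.
Implicit Types (m w : V -> V -> V) (N : V -> V) (a b c x y z : V) (t : R).

Let linearDZ {f : V -> V} : linear f ->
  {morph f : x y / x + y} * (forall t, {morph f : x / t *: x}).
Proof.
move=> lf; split=> [x y|t x]; first by have := lf 1 x y; rewrite !scale1r.
by have := lf t x 0; rewrite (linear_at0 lf) !addr0.
Qed.

(** The product of [deform L w t], once the 2-cochain is read as the binary operation
    [fun x => w (fun=> x)]. *)
Definition pencil m w t x y := m x y + t *: w x y.

Let pencil_collect t a b c d :
  (a + t *: b) + t *: (c + t *: d) = a + t *: (b + c) + t ^+ 2 *: d.
Proof. by rewrite !scalerDr scalerA -expr2 !addrA. Qed.

Let cubic_collect t a b c b' c' d :
  (a + t *: b + t ^+ 2 *: c) + t *: (b' + t *: c' + t ^+ 2 *: d) =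
  a + t *: (b + b') + t ^+ 2 *: (c + c') + t ^+ 3 *: d.
Proof.
rewrite !scalerDr !scalerA -expr2 -exprS !addrA; congr (_ + _ + _).
by rewrite addrAC.
Qed.

Let quadraticB t a b c a' b' c' :
  (a + t *: b + t ^+ 2 *: c) - (a' + t *: b' + t ^+ 2 *: c') =
  (a - a') + t *: (b - b') + t ^+ 2 *: (c - c').
Proof.
by rewrite !scalerBr opprD addrACA; congr (_ + _); rewrite opprD addrACA.
Qed.

(* The coefficient of [t] in the associator of [m + t w]. *)
Definition assoc1 m w x y z :=
  (m (w x y) z + w (m x y) z) - (m x (w y z) + w x (m y z)).

Lemma pencil_associator m w t x y z : bilinear_op m -> bilinear_op w ->
  pencil m w t (pencil m w t x y) z - pencil m w t x (pencil m w t y z) =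
  (m (m x y) z - m x (m y z)) + t *: assoc1 m w x y z
  + t ^+ 2 *: (w (w x y) z - w x (w y z)).
Proof.
move=> [m1 m2] [w1 w2]; rewrite /pencil.
rewrite (linearDZ (m1 x)).1 (linearDZ (m1 x)).2.
rewrite (linearDZ (w1 x)).1 (linearDZ (w1 x)).2.
rewrite (linearDZ (m2 z)).1 (linearDZ (m2 z)).2.
rewrite (linearDZ (w2 z)).1 (linearDZ (w2 z)).2.
by rewrite !pencil_collect quadraticB.
Qed.

(** Antisymmetrised in [x] and [y], the associator of the pencil is quadratic in [t] and vanishes on
    [I]. Its constant term is zero by left-symmetry of [m], so the coefficient of [t] must
    vanish. *)
Lemma left_symmetric_pencil m w (I : set R) x y z : open I -> I 0 ->
  bilinear_op m -> bilinear_op w -> left_symmetric m ->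
  (forall t, I t -> left_symmetric (pencil m w t)) ->
  assoc1 m w x y z = assoc1 m w y x z.
Proof.
move=> oI I0 bm bw lm h; apply/eqP; rewrite -subr_eq0; apply/eqP.
apply: (@cubic_coef1_eq0 _ _ I _ ((w (w x y) z - w x (w y z))
    - (w (w y x) z - w y (w x z))) 0) => // t It.
have /eqP := h t It x y z; rewrite -subr_eq0 !pencil_associator// quadraticB.
by rewrite (lm x y z) subrr add0r scaler0 addr0 => /eqP.
Qed.

Lemma pencil_morphism m w w' N (I : set R) x y : open I -> I 0 ->
  bilinear_op m -> bilinear_op w' -> linear N ->
  (forall t, I t -> pencil m w t x y + t *: N (pencil m w t x y) =
    pencil m w' t (x + t *: N x) (y + t *: N y)) ->
  w x y = w' x y + (m x (N y) + m (N x) y - N (m x y)).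
Proof.
move=> oI I0 [m1 m2] [w1 w2] lN h; apply/eqP; rewrite -subr_eq0; apply/eqP.
(* Regroups the goal as the coefficient of [t] on the left of the hypothesis minus the one on its
   right; the two constant terms are both [m x y]. *)
rewrite opprD opprB [- w' x y + _]addrC 2!addrA -addrA -opprD.
apply: (@cubic_coef1_eq0 _ _ I _
   (N (w x y) - (m (N x) (N y) + (w' x (N y) + w' (N x) y)))
   (- w' (N x) (N y))) => // t It.
have /eqP := h t It; rewrite -subr_eq0 /pencil.
rewrite (linearDZ lN).1 (linearDZ lN).2 pencil_collect.
have expand (b : V -> V -> V) : bilinear_op b -> b (x + t *: N x) (y + t *: N y) =
    b x y + t *: (b x (N y) + b (N x) y) + t ^+ 2 *: b (N x) (N y).
  move=> [b1 b2]; rewrite (linearDZ (b2 _)).1 (linearDZ (b2 _)).2.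
  rewrite !(linearDZ (b1 _)).1 !(linearDZ (b1 _)).2.
  by rewrite pencil_collect.
rewrite !expand// cubic_collect [- (_ + _ + _ + _)]opprD addrA quadraticB.
by rewrite subrr add0r scalerN => /eqP.
Qed.

End BilinearPencil.

Section DeformationCochains.
Context {R : realType} {n : nat} {M : manifold R n} {A : vbundle M}.

Lemma fscale0l (s : section A) : (0 : smooth_fun M) ** s = 0.
Proof.
by apply/val_inj; apply: functional_extensionality_dep => p /=; rewrite scale0r.
Qed.

Lemma bmap_sectionZ (F : bundle_map A A) f (s : section A) :
  bmap_section F (f ** s) = f ** bmap_section F s.
Proof.
by apply/val_inj; apply: functional_extensionality_dep => p /=; rewrite linearZ.
Qed.

Lemma fscale_cst (a : R) (s : section A) : (a *: (1 : smooth_fun M)) ** s = a *: s.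
Proof.
apply/val_inj; apply: functional_extensionality_dep => p /=.
by congr (_ *: _); exact: mulr1.
Qed.

Lemma bmap_section_linear (F : bundle_map A A) : linear (bmap_section F).
Proof.
by move=> a s u; apply/val_inj; apply: functional_extensionality_dep => p /=; rewrite linearP.
Qed.

Lemma bmap_section_id_plus (t : R) (N : bundle_map A A) s :
  bmap_section (id_plus t N) s = s + t *: bmap_section N s.
Proof. exact/val_inj. Qed.

Lemma upd_ord1 (T : Type) (x : 'I_1 -> T) i u : upd x i u = fun=> u.
Proof. by apply/funext => j; rewrite /upd !ord1 eqxx. Qed.

(** Real scalars act as constant functions, and over ['I_1] updating the only slot replaces the
    whole family. *)
Lemma Der2_linear1 (w : cochain A 2) (y : section A) :
  Der A 2 w -> linear (fun u => w (fun=> u) y).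
Proof.
case=> h _ _ _ a u v; have := h ord0 (fun=> 0) (a *: (1 : smooth_fun M)) u v y.
by rewrite !upd_ord1 !fscale_cst.
Qed.

(** A 1-cochain takes an empty family before its last argument, hence the form [fun=> phi]; being
    tensorial means having symbol 0. *)
Lemma Der1_tensorial (phi : section A -> section A) : linear phi ->
  (forall f y, phi (f ** y) = f ** phi y) -> Der A 1 (fun=> phi).
Proof.
move=> lphi fphi; split=> //; [by case|by move=> x []|].
exists 0 => x f y; rewrite fphi.
suff -> : hom_act 0 x f = 0 by rewrite fscale0l addr0.
by apply/val_inj/funext.
Qed.

Lemma d_def1E (L : algebroid_data A) (phi : section A -> section A) x z :
  @d_def _ _ _ _ L 1 (fun=> phi) x z =
  lprod L (x ord0) (phi z) + lprod L (phi (x ord0)) z - phi (lprod L (x ord0) z).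
Proof.
rewrite /d_def !big_ord_recl !big_ord0 /= big_mkcond big_ord1 /=.
by rewrite expr0 !scale1r !addr0.
Qed.

(** The bracket term splits by additivity of [w] in its first argument, which supplies the two
    summands of type [w (m x y) z]; the other six come from the single sums. *)
Lemma d_def2E (L : algebroid_data A) (w : cochain A 2) x z : Der A 2 w ->
  let W u := w (fun=> u) in
  d_def L w x z = assoc1 (lprod L) W (x ord_max) (x ord0) z
                  - assoc1 (lprod L) W (x ord0) (x ord_max) z.
Proof.
move=> Dw W; pose x0 := x ord0; pose x1 := x ord_max.
rewrite /d_def !big_ord_recl !big_ord0 /=.
have e1 : lift ord0 ord0 = ord_max :> 'I_2 by apply/val_inj.
have -> : x \o lift ord0 = fun=> x1.
  by apply/funext => i; rewrite /= ord1 e1.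
have -> : x \o lift (lift ord0 ord0) = fun=> x0.
  by apply/funext => i; rewrite /= /x0; congr (x _); apply/val_inj; rewrite /= ord1.
rewrite !big_mkcond !big_ord_recl !big_ord0 /=.
rewrite big_mkcond !big_ord_recl !big_ord0 /= e1.
have -> : bracket_args L x ord0 ord_max = fun=> bracket L x0 x1.
  by apply/funext => -[[|//] hi].
have WB : w (fun=> bracket L x0 x1) z = W (lprod L x0 x1) z - W (lprod L x1 x0) z.
  have := Der2_linear1 _ z Dw (-1) (lprod L x1 x0) (lprod L x0 x1).
  by rewrite !scaleN1r ![- _ + _]addrC.
rewrite !addr0 add0r expr0 expr1 !scale1r !scaleN1r WB /assoc1 /W.
rewrite !opprD !opprK !addrA.
(* The permutation puts the eight summands of the coboundary in the order of the right-hand side. *)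
by rewrite [LHS](ACl (3*8*2*5*4*7*1*6)).
Qed.

End DeformationCochains.

Theorem theorem6p3 (R : realType) (n : nat) (M : manifold R n) (A : vbundle M)
    (L : algebroid_data A) (hL : left_symmetric_algebroid L)
    (I : set R) (I_open : open I) (I_itv : is_interval I) (I0 : I 0) :
  (forall w : cochain A 2, generates_deformation L I w -> d_def L w = 0) /\
  (forall w w' : cochain A 2,
     generates_deformation L I w -> generates_deformation L I w' ->
     equivalent_deformations L I w w' ->
     exists2 c : set (cochain A 2), H_def L 2 c & c w /\ c w').
Proof.
have [bL lsL _ _] := hL.
have bDer w : Der A 2 w -> bilinear_op (fun x => w (fun=> x)).
  move=> Dw; split=> [x|y]; last exact: Der2_linear1.
  by have [_ _ + _] := Dw; apply.
have closed w : generates_deformation L I w -> d_def L w = 0.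
  move=> [Dw hw]; apply/funext => x; apply/funext => z; rewrite d_def2E//.
  apply/eqP; rewrite subr_eq0; apply/eqP.
  apply: left_symmetric_pencil I_open I0 bL (bDer w Dw) lsL _.
  by move=> t It; have [] := hw t It.
split=> // w w' hw hw' [N hN].
have E x z : w x z = w' x z + @d_def _ _ _ _ L 1 (fun=> bmap_section N) x z.
  rewrite d_def1E.
  (* A family over ['I_1] is constant, which turns [w x] into the binary operation at [x ord0]. *)
  have -> : x = fun=> x ord0 by apply/funext => i; rewrite ord1.
  apply: (@pencil_morphism _ _ (lprod L) (fun u => w (fun=> u)) (fun u => w' (fun=> u))
    (bmap_section N) I (x ord0) z) => //.
  - exact: bDer hw'.1.
  - exact: bmap_section_linear.
  - by move=> t It; have [_ + _] := hN t It => /(_ (x ord0) z); rewrite !bmap_section_id_plus.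
(* The common class is the coset of [w']: it contains [w] through the coboundary of [N], by [E]. *)
exists [set w' + b | b in coboundaries L 2].
  by exists w' => //; split; [exact: hw'.1|exact: closed].
have Dbm (phi : section A -> section A) : linear phi ->
  (forall f y, phi (f ** y) = f ** phi y) ->
  coboundaries L 2 (@d_def _ _ _ _ L 1 (fun=> phi)).
  by move=> lp fp; exists (fun=> phi) => //; exact: Der1_tensorial.
split.
  exists (@d_def _ _ _ _ L 1 (fun=> bmap_section N)).
    apply: Dbm; [exact: bmap_section_linear|exact: bmap_sectionZ].
  by apply/funext => x; apply/funext => z; rewrite E.
(* Coboundaries form an image set, so 0 is exhibited as the coboundary of the zero cochain. *)
exists (@d_def _ _ _ _ L 1 (fun=> fun=> 0)).
  apply: Dbm; first by move=> a u v; rewrite scaler0 addr0.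
  by move=> f y; apply/val_inj; apply: functional_extensionality_dep => p /=; rewrite scaler0.
apply/funext => x; apply/funext => z; rewrite -[RHS]addr0.
by congr (_ + _); rewrite d_def1E (linear_at0 (bL.1 _)) (linear_at0 (bL.2 _)) subr0 addr0.
Qed.
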